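(* Let $\{J,E\}$ be a complex product structure on a $4$-dimensional real Lie algebra $\mathfrak{g}$. If $g$ and $h$ are two metrics on $\mathfrak{g}$ compatible with $\{J,E\}$, then there exists $\lambda\in\mathbb{R}\setminus\{0\}$ such that $h=\lambda g$.
   Context: A complex structure on a Lie algebra $\mathfrak{g}$ is a linear endomorphism $J$ with $J^2=-\mathrm{Id}$ and $J[x,y]=[Jx,y]+[x,Jy]+J[Jx,Jy]$ for all $x,y$. A product structure is a linear endomorphism $E\neq\pm\mathrm{Id}$ with $E^2=\mathrm{Id}$ and $E[x,y]=[Ex,y]+[x,Ey]-E[Ex,Ey]$ for all $x,y$. A complex product structure is a pair $\{J,E\}$ of a complex structure and a product structure with $JE=-EJ$. A metric on $\mathfrak g$ is a nondegenerate symmetric bilinear form $g:\mathfrak g\times\mathfrak g\to\mathbb R$; it is compatible with $\{J,E\}$ if $g(Jx,Jy)=g(x,y)$ and $g(Ex,Ey)=-g(x,y)$ for all $x,y\in\mathfrak g$. *)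

(* Defs.v *)
From HB Require Import structures.
From mathcomp Require Import all_boot all_order all_algebra.
From mathcomp Require Import reals.

Set Implicit Arguments.
Unset Strict Implicit.
Unset Printing Implicit Defensive.

Import GRing.Theory.
Local Open Scope ring_scope.

HB.mixin Record Vector_isLieAlgebra (K : fieldType) L of Vector K L := {
  lie_bracket : {bilinear L -> L -> L};
  lie_bracketxx : forall x : L, lie_bracket x x = 0;
  lie_jacobi : forall x y z : L,
    lie_bracket x (lie_bracket y z) + lie_bracket y (lie_bracket z x)
    + lie_bracket z (lie_bracket x y) = 0
}.

(* Finite-dimensional Lie algebras over K. *)
#[short(type="lieAlgType")]
HB.structure Definition LieAlgebra (K : fieldType) :=
  {L of Vector_isLieAlgebra K L & Vector K L}.

Notation "[ 'lie' x , y ]" := (lie_bracket x y)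
  (at level 0, x at level 99, y at level 99, format "[ 'lie'  x ,  y ]")
  : ring_scope.

Section ComplexProduct.
Variables (K : fieldType) (L : lieAlgType K).

Definition complex_structure (J : 'End(L)) : Prop :=
  (J \o J)%VF = - \1%VF /\
  forall x y : L,
    J [lie x, y] = [lie J x, y] + [lie x, J y] + J [lie J x, J y].

Definition product_structure (E : 'End(L)) : Prop :=
  [/\ E <> \1%VF, E <> - \1%VF, (E \o E)%VF = \1%VF &
   forall x y : L,
     E [lie x, y] = [lie E x, y] + [lie x, E y] - E [lie E x, E y]].

Definition complex_product_structure (J E : 'End(L)) : Prop :=
  [/\ complex_structure J, product_structure E & (J \o E)%VF = - (E \o J)%VF].

Definition compatible_metric (J E : 'End(L)) (g : {symmetric L}) : Prop :=
  [/\ nondegenerate g,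
   forall x y : L, g (J x) (J y) = g x y &
   forall x y : L, g (E x) (E y) = - g x y].

End ComplexProduct.

(* Main.v *)
Require Import Defs.
From mathcomp Require Import all_boot all_order all_algebra.
From mathcomp Require Import reals.

Import GRing.Theory.
Local Open Scope ring_scope.

(** Let [P] be the eigenspace of [E] for the eigenvalue 1. Since [J]
    anticommutes with [E], it carries [P] onto the eigenspace for -1, so that
    the whole space is the direct sum of [P] and [J @: P] and [\dim P = 2].

    A symmetric form [g] with [g (E x) (E y) = - g x y] vanishes on [P] and on
    [J @: P], so it is determined by its values [g p (J q)] for [p], [q] in [P].
    Symmetry and invariance under [J] make [(p, q) |-> g p (J q)] alternating
    on [P], and on a plane with basis [u], [v] an alternating form is a multiple
    of the determinant. Hence every compatible form is [g u (J v)] times one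
    form [paraform] that depends only on [J], [E] and the basis
    ([compatible_form_paraform]). Nondegeneracy forces [g u (J v) != 0], and
    the ratio of two such scalars is the required [lambda]. *)

Section ParahermitianForms.

#[local] Set Implicit Arguments.
#[local] Unset Strict Implicit.

Variables (K : fieldType) (L : vectType K) (J E : 'End(L)).
Hypothesis two_neq0 : 2%:R != 0 :> K.
Hypothesis JJ : forall x, J (J x) = - x.
Hypothesis EE : forall x, E (E x) = x.
Hypothesis JE : forall x, J (E x) = - E (J x).

Definition fixE : {vspace L} := lker (E - \1%VF).

Lemma fixEP x : reflect (E x = x) (x \in fixE).
Proof.
rewrite memv_ker add_lfunE opp_lfunE id_lfunE subr_eq0.
exact: eqP.
Qed.

Lemma EJ_fixE q : q \in fixE -> E (J q) = - J q.
Proof. by move=> /fixEP Eq; rewrite -{2}Eq JE opprK. Qed.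

(** [partP] is the projection onto [fixE]; [partJ] is the projection onto the
    eigenspace for -1, brought back into [fixE] by [J^-1 = - J]. *)
Definition partP x := 2%:R^-1 *: (x + E x).
Definition partJ x := - J (2%:R^-1 *: (x - E x)).

Lemma partP_fixE x : partP x \in fixE.
Proof. by apply/fixEP; rewrite linearZ linearD /= EE addrC. Qed.

Lemma partJ_fixE x : partJ x \in fixE.
Proof.
apply/fixEP; rewrite /partJ linearN /= -JE linearZ linearB /= EE.
by rewrite -[E x - x]opprB scalerN linearN.
Qed.

Lemma partPJ x : x = partP x + J (partJ x).
Proof.
rewrite /partJ linearN /= JJ opprK -scalerDr addrACA subrr addr0.
by rewrite -mulr2n -scaler_nat scalerA mulVf // scale1r.
Qed.

Lemma dim_fixE : \dim {:L} = (\dim fixE).*2.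
Proof.
(* The eigenspace for -1 is [J @: fixE], of the same dimension as [fixE]. *)
have kerJ : lker J == 0%VS.
  apply/lker0P => x y /(congr1 J); rewrite !JJ; exact: oppr_inj.
have dimJ : \dim (J @: fixE) = \dim fixE.
  by apply: limg_dim_eq; rewrite (eqP kerJ) capv0.
have capJ : (fixE :&: J @: fixE = 0)%VS.
  apply/eqP; rewrite -subv0; apply/subvP => x.
  rewrite memv_cap memv0 => /andP[/fixEP Ex /memv_imgP[q Pq xJq]].
  have xN : x = - x by rewrite -{1}Ex xJq EJ_fixE.
  have : 2%:R *: x = 0 by rewrite scaler_nat mulr2n {2}xN subrr.
  by move/eqP; rewrite scaler_eq0 (negPf two_neq0).
have -> : fullv = (fixE + J @: fixE)%VS.
  apply/eqP; rewrite eqEsubv subvf andbT; apply/subvP => x _.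
  by rewrite (partPJ x) memv_add ?memv_img ?partP_fixE ?partJ_fixE.
by rewrite dimv_disjoint_sum // dimJ addnn.
Qed.

Definition fixE_basis i : L := (vbasis fixE)`_i.

Lemma fixE_plane : \dim {:L} = 4%N ->
  exists c1 c2 : L -> K,
    forall p, p \in fixE -> p = c1 p *: fixE_basis 0 + c2 p *: fixE_basis 1.
Proof.
rewrite dim_fixE => /(@double_inj _ 2) dim2.
have i0 : (0 < \dim fixE)%N by rewrite dim2.
have i1 : (1 < \dim fixE)%N by rewrite dim2.
exists (coord (vbasis fixE) (Ordinal i0)), (coord (vbasis fixE) (Ordinal i1)).
move=> p /coord_vbasis {1}->.
rewrite (bigD1 (Ordinal i0)) //= (bigD1 (Ordinal i1)) //= big1 ?addr0 //.
by case=> [[|[|i]] lti] //; have := lti; rewrite [X in (_ < X)%N -> _]dim2.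
Qed.

(** When [c1] and [c2] are the coordinates of [fixE] in a basis [u], [v], this
    is the compatible form normalized to take the value 1 at [u], [J v]. The
    inner [det] is the area form of the plane [fixE]; a compatible form pairs
    [fixE] with [J @: fixE] through it, whence one term for each order. *)
Definition paraform (c1 c2 : L -> K) x y :=
  let det p q := c1 p * c2 q - c2 p * c1 q in
  det (partP x) (partJ y) + det (partP y) (partJ x).

Section Form.

Variable g : {symmetric L}.
Hypothesis gJ : forall x y, g (J x) (J y) = g x y.
Hypothesis gE : forall x y, g (E x) (E y) = - g x y.

Lemma form_sym x y : g x y = g y x.
Proof. by rewrite hermC expr0 mul1r. Qed.

Lemma eq_opp_eq0 (a : K) : a = - a -> a = 0.
Proof.
move=> aN; apply/eqP; have : 2%:R * a == 0 by rewrite mulr_natl mulr2n {2}aN subrr.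
by rewrite mulf_eq0 (negPf two_neq0).
Qed.

Lemma form_fixE_isotropic p q : p \in fixE -> q \in fixE -> g p q = 0.
Proof.
by move=> /fixEP Ep /fixEP Eq; apply: eq_opp_eq0; rewrite -gE Ep Eq.
Qed.

Lemma form_twist_skew p q : g p (J q) = - g q (J p).
Proof. by rewrite -gJ JJ linearNr form_sym. Qed.

Lemma form_twist_alt p : g p (J p) = 0.
Proof. exact/eq_opp_eq0/form_twist_skew. Qed.

Lemma form_split x y :
  g x y = g (partP x) (J (partJ y)) + g (partP y) (J (partJ x)).
Proof.
rewrite {1}(partPJ x) {1}(partPJ y) linearDl !linearDr /= gJ.
rewrite (form_fixE_isotropic (partP_fixE x) (partP_fixE y)).
rewrite (form_fixE_isotropic (partJ_fixE x) (partJ_fixE y)) add0r addr0.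
by rewrite [g (J _) _]form_sym.
Qed.

(** On the plane [fixE] the alternating form [(p, q) |-> g p (J q)] is a
    multiple of the determinant, so the whole of [g] depends on one scalar. *)
Lemma compatible_form_paraform c1 c2 :
    (forall p, p \in fixE -> p = c1 p *: fixE_basis 0 + c2 p *: fixE_basis 1) ->
  forall x y, g x y = g (fixE_basis 0) (J (fixE_basis 1)) * paraform c1 c2 x y.
Proof.
move=> coordE x y.
have twist p q : p \in fixE -> q \in fixE ->
    g p (J q) = g (fixE_basis 0) (J (fixE_basis 1)) * (c1 p * c2 q - c2 p * c1 q).
  move=> /coordE {1}-> /coordE {1}->.
  rewrite linearDl !linearZl_LR /= !linearD !linearZ /=.
  rewrite !form_twist_alt [g (fixE_basis 1) _]form_twist_skew.
  by rewrite !mulr0 add0r addr0 !mulrN !mulrA -mulrBl mulrC.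
rewrite form_split (twist _ _ (partP_fixE x) (partJ_fixE y)).
by rewrite (twist _ _ (partP_fixE y) (partJ_fixE x)) -mulrDr.
Qed.

End Form.

End ParahermitianForms.

Lemma nondegenerate_neq0 (K : fieldType) (L : vectType K) (g : {symmetric L}) :
  (0 < \dim {:L})%N -> nondegenerate g -> ~ (forall x y, g x y = 0).
Proof.
move=> dim_gt0 /eqP rad0 g0.
have rad1 : (fullv <= orthov g fullv)%VS by apply/orthovP => x y _ _.
by move: (dimvS rad1); rewrite rad0 dimv0 leqNgt dim_gt0.
Qed.

Theorem lemma6p1 (R : realType) (L : lieAlgType R) (dimL : \dim {:L} = 4%N)
    (J E : 'End(L)) (JE : complex_product_structure J E)
    (g h : {symmetric L})
    (gJE : compatible_metric J E g) (hJE : compatible_metric J E h) :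
  exists lambda : R, lambda != 0 /\ forall x y : L, h x y = lambda * g x y.
Proof.
have [[JJ _] [_ _ EE _] JEN] := JE.
have two_neq0 : 2%:R != 0 :> R by rewrite Num.Theory.pnatr_eq0.
have JJx x : J (J x) = - x.
  by rewrite -[J (J x)]comp_lfunE JJ opp_lfunE id_lfunE.
have EEx x : E (E x) = x by rewrite -[E (E x)]comp_lfunE EE id_lfunE.
have JEx x : J (E x) = - E (J x).
  by rewrite -[J (E x)]comp_lfunE JEN opp_lfunE comp_lfunE.
have [c1 [c2 coordE]] := fixE_plane two_neq0 JJx EEx JEx dimL.
(* The scalar is nonzero, since otherwise the whole form would vanish. *)
have scaleE k : compatible_metric J E k ->
    k (fixE_basis E 0) (J (fixE_basis E 1)) != 0 /\
    forall x y, k x y =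
      k (fixE_basis E 0) (J (fixE_basis E 1)) * paraform J E c1 c2 x y.
  case=> nd kJ kE.
  have kD := compatible_form_paraform two_neq0 JJx EEx JEx kJ kE coordE.
  split=> //; apply/eqP => k0.
  have dim_gt0 : (0 < \dim {:L})%N by rewrite dimL.
  by case: (nondegenerate_neq0 _ _ k dim_gt0 nd) => x y; rewrite kD k0 mul0r.
have [g0 gD] := scaleE _ gJE; have [h0 hD] := scaleE _ hJE.
exists (h (fixE_basis E 0) (J (fixE_basis E 1)) /
          g (fixE_basis E 0) (J (fixE_basis E 1))).
split=> [|x y]; first by rewrite mulf_neq0 ?invr_eq0.
by rewrite hD (gD x y) mulrA divfK.
Qed.
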